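(* Let $f:\mathbb{R}^d\to\mathbb{R}$, let $X\subseteq\mathbb{R}^d$ be a measurable set, and assume $f$ is $L$-smooth over $\mathbb{R}^d\setminus X$. Let $W\subseteq\mathbb{R}^d$ be a measurable set with $0<\mathcal{L}(W)<\infty$. Run gradient descent $x_t = x_{t-1}-\gamma\nabla f(x_{t-1})$ with learning rate $\gamma\le \frac{1}{2L}$, where $x_0$ is drawn uniformly at random from $W$. Then for every $T\ge 1$, the probability that $x_i\in X$ for some $1\le i\le T$ is at most $2^{(T+1)\cdot d}\cdot\frac{\mathcal{L}(X)}{\mathcal{L}(W)}$.
   Context: $\mathcal{L}(S)$ denotes the Lebesgue measure of a set $S\subseteq\mathbb{R}^d$. A function $f$ is $L$-smooth over a set $S$ if it is differentiable and there is a constant $L>0$ with $\|\nabla f(x)-\nabla f(y)\|\le L\|x-y\|$ for all $x,y\in S$. ''Random initialization on $W$'' means $x_0$ is sampled uniformly from $W$. *)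

(* Defs.v *)
From HB Require Import structures.
From mathcomp Require Import all_boot all_order all_algebra.
From mathcomp Require Import all_classical all_reals all_analysis.
Set Implicit Arguments. Unset Strict Implicit. Unset Printing Implicit Defensive.
Import Order.TTheory GRing.Theory Num.Theory.
Import numFieldNormedType.Exports.
Local Open Scope classical_set_scope.
Local Open Scope ring_scope.

Definition enorm (R : realType) (d : nat) (v : 'rV[R]_d) : R :=
  Num.sqrt (\sum_(i < d) (v 0 i) ^+ 2).

Definition box (R : realType) (d : nat) (a b : 'rV[R]_d) : set 'rV[R]_d :=
  [set x | forall i : 'I_d, a 0 i <= x 0 i /\ x 0 i < b 0 i].

Definition box_vol (R : realType) (d : nat) (a b : 'rV[R]_d) : R :=
  \prod_(i < d) Num.max 0 (b 0 i - a 0 i).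

Definition leb (R : realType) (d : nat) (A : set 'rV[R]_d) : \bar R :=
  ereal_inf [set s : \bar R | exists (a b : nat -> 'rV[R]_d),
     A `<=` \bigcup_k box (a k) (b k) /\
     s = (\sum_(k <oo) (box_vol (a k) (b k))%:E)%E].

Definition leb_measurable (R : realType) (d : nat) (A : set 'rV[R]_d) : Prop :=
  forall B : set 'rV[R]_d, leb B = (leb (B `&` A) + leb (B `&` ~` A))%E.

Definition grad (R : realType) (d : nat) (f : 'rV[R]_d -> R) (x : 'rV[R]_d)
  : 'rV[R]_d := \row_(i < d) ('d f x (delta_mx 0 i : 'rV[R]_d)).

Definition L_smooth_on (R : realType) (d : nat) (f : 'rV[R]_d -> R) (L : R)
  (S : set 'rV[R]_d) : Prop :=
  0 < L /\ (forall x, S x -> differentiable f x) /\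
  (forall x y, S x -> S y -> enorm (grad f x - grad f y) <= L * enorm (x - y)).

Definition gd (R : realType) (d : nat) (f : 'rV[R]_d -> R) (gamma : R)
  (x0 : 'rV[R]_d) (t : nat) : 'rV[R]_d :=
  iter t (fun x => x - gamma *: grad f x) x0.

Definition unif_prob (R : realType) (d : nat) (W E : set 'rV[R]_d) : R :=
  fine (leb (W `&` E)) / fine (leb W).

(* Main.v *)
(* Off X the step map g x = x - gamma * grad f x satisfies
   |x - y| <= 2 |g x - g y|, so pulling a set back through g and intersecting it
   with the complement of X multiplies its outer measure by at most 2^d.  The
   runs that first meet X at time i form such an i-fold pull-back of X, and
   sum_(i <= T) 2^(i d) <= 2^((T+1) d).

   The sharp constant 2^d requires comparing Lebesgue measure with the Hausdorff
   content H, for which a K-Lipschitz image costs at most K^d by definition.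
   With c the content of the unit cube, H = c * leb on every set: H <= c * leb
   because boxes are nearly unions of small cubes, and c * leb <= H because
   c * leb S <= (diam S)^d, which follows from the subadditivity of H alone. *)
Require Import Defs.
From HB Require Import structures.
From mathcomp Require Import all_boot all_order all_algebra.
From mathcomp Require Import all_classical all_reals all_analysis.
From mathcomp Require Import ring lra.
Import Order.TTheory GRing.Theory Num.Theory.
Import numFieldNormedType.Exports.
Local Open Scope classical_set_scope.
Local Open Scope ring_scope.

(** * Outer measures generated by countable covers *)

Section CoverContent.
Local Open Scope ereal_scope.
Context {R : realType} {T : choiceType}.
Implicit Types (P : set T -> R -> Prop) (A B : set T).

(** [P S w] allows the piece [S] at price [w]. A relation lets one set carry many prices, as in
    [diam_piece], and makes both [leb] and the Hausdorff content instances. *)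
Definition cover_content P A : \bar R :=
  ereal_inf [set s | exists (S : nat -> set T) (w : nat -> R),
    [/\ forall k, P (S k) (w k), A `<=` \bigcup_k S k &
        s = \sum_(k <oo) (w k)%:E]].

Context {P : set T -> R -> Prop}.
Hypothesis P0 : P set0 0%R.
Hypothesis P_ge0 : forall S w, P S w -> (0 <= w)%R.
Local Notation mu := (cover_content P).

Lemma cover_content_ge0 A : 0 <= mu A.
Proof.
apply: le_ereal_inf_tmp => _ [S [w [PSw _ ->]]].
by apply: nneseries_ge0 => k _ _; rewrite lee_fin; exact: P_ge0 (PSw k).
Qed.

Lemma le_cover_content A B : A `<=` B -> mu A <= mu B.
Proof.
move=> AB; apply: ereal_inf_le_tmp => _ [S [w [PSw BS ->]]].
by exists S, w; split => //; exact: subset_trans BS.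
Qed.

Lemma cover_content_piece S w : P S w -> mu S <= w%:E.
Proof.
move=> PSw; apply: ereal_inf_lbound.
exists (fun k => if k == 0%N then S else set0),
       (fun k => if k == 0%N then w else 0%R); split.
- by case.
- by move=> x Sx; exists 0%N.
- rewrite (@nneseries_split _ _ 0 1) => [|k _]; last first.
    by rewrite lee_fin; case: ifP => // _; exact: P_ge0 PSw.
  by rewrite big_nat1 eseries0 ?adde0// => -[].
Qed.

Lemma cover_content0 : mu set0 = 0.
Proof.
by apply/eqP; rewrite eq_le cover_content_ge0 andbT; exact: cover_content_piece.
Qed.

(** Near-optimal covers of the [A n], with errors [e / 2 ^ n.+1], are merged into one along a
    bijection between [nat] and [nat * nat]. *)
Lemma cover_content_bigcup (A : nat -> set T) :
  mu (\bigcup_n A n) <= \sum_(n <oo) mu (A n).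
Proof.
have [[n Anoo]|/forallNP Aoo] := pselect (exists n, mu (A n) = +oo).
  by rewrite (eseries_pinfty _ _ Anoo) ?leey// => i _;
    rewrite -ltNye (lt_le_trans _ (cover_content_ge0 _)).
apply/lee_addgt0Pr => e e0.
rewrite (le_trans _ (epsilon_trick _ _ (ltW e0)))//; last first.
  by move=> n; exact: cover_content_ge0.
pose good n (G : (nat -> set T) * (nat -> R)) :=
  [/\ forall k, P (G.1 k) (G.2 k), A n `<=` \bigcup_k G.1 k &
      \sum_(k <oo) (G.2 k)%:E <= mu (A n) + (e / (2 ^ n.+1)%:R)%:E].
have [G PG] : {G & forall n, good n (G n)}.
  apply: (@choice _ _ good) => n.
  have en : (0 < e / (2 ^ n.+1)%:R)%R by rewrite divr_gt0// ltr0n expn_gt0.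
  have fA : mu (A n) \is a fin_num.
    by rewrite ge0_fin_numE ?cover_content_ge0// ltey; apply/eqP/Aoo.
  have [_ [S [w [PSw AS ->]]] lt_w] := lb_ereal_inf_adherent en fA.
  by exists (S, w); split => //; exact: ltW.
pose u (p : nat * nat) := ((G p.1).2 p.2)%:E.
have u0 p : 0 <= u p.
  by have [/(_ p.2) /P_ge0] := PG p.1.
have /card_esym/ppcard_eqP[f] := card_nat2.
apply: (@le_trans _ _ (\sum_(k <oo) u (f k))).
  apply: ereal_inf_lbound.
  exists (fun k => (G (f k).1).1 (f k).2), (fun k => (G (f k).1).2 (f k).2).
  split=> //.
    by move=> k; have [/(_ (f k).2)] := PG (f k).1.
  move=> x [n _ Anx]; have [_ /(_ x Anx) [k _ Gx] _] := PG n.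
  by exists (f^-1%FUN (n, k)) => //=; rewrite invK ?inE.
rewrite nneseries_esumT// -(reindex_esum setT setT f u)//.
have -> : [set: nat * nat] = setT `*`` (fun=> setT).
  by apply/seteqP; split.
rewrite -(@esum_esum _ _ _ _ _ (fun i j => u (i, j)))//.
rewrite -nneseries_esumT => [|n]; last by apply: esum_ge0.
apply: lee_nneseries => [n _ _|n _]; first by apply: esum_ge0.
by rewrite -nneseries_esumT//; have [] := PG n.
Qed.

Lemma cover_contentU A B : mu (A `|` B) <= mu A + mu B.
Proof.
have := cover_content_bigcup (fun k => if k == 0%N then A else if k == 1%N then B else set0).
rewrite (_ : \bigcup_n _ = A `|` B); last first.
  apply/seteqP; split=> x.
    by move=> [[|[|]]//= _]; [left|right].
  by case=> ?; [exists 0%N|exists 1%N].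
rewrite (@nneseries_split _ _ 0 2) => [|k _]; last exact: cover_content_ge0.
by rewrite big_nat_recr//= big_nat1 eseries0 ?adde0// => -[|[|k]]// _ _;
  rewrite cover_content0.
Qed.

Lemma cover_content_bigsetU (I : Type) (r : seq I) (F : I -> set T) :
  mu (\big[setU/set0]_(i <- r) F i) <= \sum_(i <- r) mu (F i).
Proof.
elim: r => [|i r IH]; first by rewrite !big_nil cover_content0.
rewrite !big_cons; apply: le_trans (cover_contentU _ _) _.
by rewrite leeD2l.
Qed.

End CoverContent.

(** Covers of [A] pull back along [g] piece by piece, so by countable subadditivity a bound on
    single pieces is enough. *)
Lemma cover_content_transport {R : realType} {T U : choiceType}
    {P : set T -> R -> Prop} {Q : set U -> R -> Prop} {F : set T} {g : T -> U}
    {K : R} {A : set U} :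
  P set0 0 -> (forall S w, P S w -> 0 <= w) -> (forall S w, Q S w -> 0 <= w) ->
  0 < K ->
  (forall S w, Q S w ->
     (cover_content P (F `&` g @^-1` S) <= (K * w)%:E)%E) ->
  (cover_content P (F `&` g @^-1` A) <= K%:E * cover_content Q A)%E.
Proof.
move=> P0 P_ge0 Q_ge0 K0 QP; rewrite -lee_pdivrMl//.
apply: le_ereal_inf_tmp => _ [S [w [QSw AS ->]]]; rewrite lee_pdivrMl//.
rewrite -nneseriesZl; last by move=> k _; rewrite lee_fin; exact: Q_ge0 (QSw k).
apply: (@le_trans _ _ (cover_content P (\bigcup_k (F `&` g @^-1` S k)))).
  by apply: le_cover_content => x [Fx /AS[k _ Sk]]; exists k.
apply: (le_trans (cover_content_bigcup P_ge0 _)).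
apply: lee_nneseries => [k _ _|k _]; first exact: cover_content_ge0.
by rewrite -EFinM; exact: QP.
Qed.

(** * The Euclidean norm on row vectors *)

Section EuclideanNorm.
Context {R : realType} {d : nat}.
Implicit Types (u v : 'rV[R]_d).

Lemma sqr_enorm v : enorm v ^+ 2 = \sum_(i < d) v 0 i ^+ 2.
Proof. by rewrite sqr_sqrtr// sumr_ge0// => i _; exact: sqr_ge0. Qed.

Lemma enorm_ge0 v : 0 <= enorm v.
Proof. exact: sqrtr_ge0. Qed.

Lemma enormZ (a : R) v : enorm (a *: v) = `|a| * enorm v.
Proof.
rewrite /enorm -sqrtr_sqr -sqrtrM ?sqr_ge0// mulr_sumr.
by congr Num.sqrt; apply: eq_bigr => i _; rewrite !mxE exprMn.
Qed.

(** With [a] and [b] the two norms, the sum of the squares of [b * u 0 i - a * v 0 i] is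
    [2 * (a * b)] times the gap between the two sides; a vanishing norm is treated apart. *)
Lemma enorm_CauchySchwarz u v :
  \sum_(i < d) u 0 i * v 0 i <= enorm u * enorm v.
Proof.
have [ab0|] := eqVneq (enorm u * enorm v) 0; last first.
  set a := enorm u; set b := enorm v => ab0.
  have ab_gt0 : 0 < a * b by rewrite lt_neqAle eq_sym ab0 mulr_ge0 ?enorm_ge0.
  have : 0 <= \sum_(i < d) (b * u 0 i - a * v 0 i) ^+ 2.
    by apply: sumr_ge0 => i _; exact: sqr_ge0.
  have -> : \sum_(i < d) (b * u 0 i - a * v 0 i) ^+ 2 =
      b ^+ 2 * (\sum_(i < d) u 0 i ^+ 2) + a ^+ 2 * (\sum_(i < d) v 0 i ^+ 2) -
      2 * (a * b) * \sum_(i < d) u 0 i * v 0 i.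
    rewrite !mulr_sumr -big_split -sumrB/=.
    by apply: eq_bigr => i _; ring.
  rewrite -!sqr_enorm -/a -/b (_ : _ - _ = 2 * (a * b) * (a * b - \sum_(i < d) u 0 i * v 0 i)).
    by rewrite pmulr_rge0 ?subr_ge0// mulr_gt0.
  by ring.
have coord0 (w : 'rV[R]_d) : enorm w = 0 -> forall i, w 0 i = 0.
  move=> w0; have /eqP := sqr_enorm w; rewrite w0 expr0n/= eq_sym.
  rewrite psumr_eq0 => [/allP wi0 i|i _]; last exact: sqr_ge0.
  by apply/eqP; rewrite -sqrf_eq0; exact: wi0 (mem_index_enum i).
rewrite ab0 big1// => i _.
by move/eqP: ab0; rewrite mulf_eq0 => /orP[] /eqP /coord0 ->;
  rewrite ?mul0r ?mulr0.
Qed.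

Lemma ler_enormD u v : enorm (u + v) <= enorm u + enorm v.
Proof.
rewrite -(@ler_pXn2r _ 2) ?nnegrE ?addr_ge0 ?enorm_ge0//.
rewrite sqrrD !sqr_enorm.
apply: (@le_trans _ _ (\sum_(i < d) u 0 i ^+ 2 +
   (\sum_(i < d) u 0 i * v 0 i) *+ 2 + \sum_(i < d) v 0 i ^+ 2)).
  rewrite -sumrMnl -!big_split/= le_eqVlt; apply/orP; left; apply/eqP.
  by apply: eq_bigr => i _; rewrite !mxE sqrrD.
by rewrite lerD2r lerD2l lerMn2r enorm_CauchySchwarz.
Qed.

(** The factor [d] is crude, but it only ever multiplies a mesh size that tends to 0 or serves to
    prove finiteness. *)
Lemma enorm_le_coord v (s : R) :
  0 <= s -> (forall i, `|v 0 i| <= s) -> enorm v <= d%:R * s.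
Proof.
move=> s0 vs; case: (posnP d) => [d0|d_gt0].
  rewrite /enorm big1 ?sqrtr0 ?mulr_ge0 ?ler0n// => i.
  by have := ltn_ord i; rewrite {2}d0.
rewrite -(@ler_pXn2r _ 2) ?nnegrE ?mulr_ge0 ?enorm_ge0 ?ler0n//.
rewrite sqr_enorm; apply: (@le_trans _ _ (\sum_(i < d) s ^+ 2)).
  by apply: ler_sum => i _; rewrite -real_normK ?num_real// lerXn2r ?nnegrE.
rewrite sumr_const card_ord -[leLHS]mulr_natl exprMn ler_wpM2r ?sqr_ge0//.
by rewrite expr2 ler_peMl ?ler0n// ler1n.
Qed.

End EuclideanNorm.

(** * Hausdorff content and its scaling on cubes *)

Section HausdorffContent.
Context {R : realType} {d : nat}.
Implicit Types (S : set 'rV[R]_d) (w : R).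

Definition box_piece S w := exists a b, S = box a b /\ w = box_vol a b.

(* The strict bound forces [0 < r] unless [S] is empty, so every nonempty piece
   fits in a half-open cube of side [2 * r]. *)
Definition diam_piece S w := exists2 r : R, 0 <= r &
  w = r ^+ d /\ forall x y, S x -> S y -> enorm (x - y) < r.

Lemma box_piece_ge0 S w : box_piece S w -> 0 <= w.
Proof.
move=> [a [b [_ ->]]]; apply: prodr_ge0 => i _.
by rewrite le_max lexx.
Qed.

Lemma diam_piece_ge0 S w : diam_piece S w -> 0 <= w.
Proof. by move=> [r r0 [-> _]]; exact: exprn_ge0. Qed.

Lemma diam_piece0 : (0 < d)%N -> diam_piece set0 0.
Proof. by move=> d0; exists 0 => //; rewrite expr0n gtn_eqF. Qed.

Lemma box_piece0 : (0 < d)%N -> box_piece set0 0.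
Proof.
move=> d0; exists 0, 0; split.
  apply/seteqP; split => // x /(_ (Ordinal d0)); rewrite mxE => -[x0].
  by rewrite ltNge x0.
apply/esym/eqP/prodf_eq0; exists (Ordinal d0) => //.
by rewrite !mxE subrr maxxx.
Qed.

Lemma lebE : @leb R d = cover_content box_piece.
Proof.
apply/funext => A; congr ereal_inf; apply/seteqP; split => s /=.
  move=> [a [b [Aab ->]]].
  exists (fun k => box (a k) (b k)), (fun k => box_vol (a k) (b k)).
  by split => // k; exists (a k), (b k).
move=> [S [w [Sw AS ->]]].
have [ab Sab] := @choice _ _ (fun k (ab : 'rV[R]_d * 'rV[R]_d) =>
  S k = box ab.1 ab.2 /\ w k = box_vol ab.1 ab.2)
  (fun k => let: ex_intro a (ex_intro b H) := Sw k in ex_intro _ (a, b) H).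
exists (fst \o ab), (snd \o ab); split => /=.
  by move=> x /AS[k _ Sk]; exists k => //; rewrite -(Sab k).1.
by congr (limn _); apply/funext => n; apply: eq_bigr => k _; rewrite (Sab k).2.
Qed.

(* Sums [r ^+ d] over all countable covers, with no bound on the size of the
   pieces. *)
Definition hcontent := cover_content diam_piece.

(** The inverse of [g] on [F] is [K]-Lipschitz, so a piece of diameter below [r] pulls back to one
    of diameter below [K * r]. *)
Lemma hcontent_expanding (F : set 'rV[R]_d) (g : 'rV[R]_d -> 'rV[R]_d)
    (K : R) (A : set 'rV[R]_d) :
  (0 < d)%N -> 0 < K ->
  (forall x y, F x -> F y -> enorm (x - y) <= K * enorm (g x - g y)) ->
  (hcontent (F `&` g @^-1` A) <= (K ^+ d)%:E * hcontent A)%E.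
Proof.
move=> d0 K0 Fg.
apply: (cover_content_transport (diam_piece0 d0) diam_piece_ge0 diam_piece_ge0).
  exact: exprn_gt0.
move=> S w [r r0 [-> Sr]]; apply: (cover_content_piece (diam_piece0 d0) diam_piece_ge0).
exists (K * r); first by rewrite mulr_ge0// ltW.
split; first by rewrite exprMn.
move=> x y [Fx Sx] [Fy Sy]; apply: le_lt_trans (Fg x y Fx Fy) _.
by rewrite ltr_pM2l//; exact: Sr.
Qed.

Definition cube (a : 'rV[R]_d) (s : R) := box a (a + const_mx s).

Lemma cubeP a s x : cube a s x <-> forall i, a 0 i <= x 0 i < a 0 i + s.
Proof.
split => [ax i|ax i].
  by have := ax i; rewrite !mxE => -[-> ->].
by have /andP[] := ax i; rewrite !mxE.
Qed.

(** The affine map taking one cube onto the other multiplies distances by [t / s]. Used in both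
    directions, this gives the exact homogeneity of [hcontent_cube]. *)
Lemma hcontent_le_scale a b (s t : R) : (0 < d)%N -> 0 < s -> 0 < t ->
  (hcontent (cube a s) <= ((s / t) ^+ d)%:E * hcontent (cube b t))%E.
Proof.
move=> d0 s0 t0; pose g (x : 'rV[R]_d) := b + (t / s) *: (x - a).
have -> : cube a s = setT `&` g @^-1` cube b t.
  rewrite setTI; apply/seteqP; split => x.
    move=> /cubeP ax; apply/cubeP => i; have /andP[ax1 ax2] := ax i.
    rewrite !mxE lerDl ltrD2l pmulr_rge0 ?divr_gt0// subr_ge0 ax1/=.
    by rewrite mulrAC ltr_pdivrMr// ltr_pM2l// ltrBlDl.
  move=> /cubeP ax; apply/cubeP => i; have := ax i.
  rewrite !mxE lerDl ltrD2l pmulr_rge0 ?divr_gt0// subr_ge0 => /andP[-> /=].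
  by rewrite mulrAC ltr_pdivrMr// ltr_pM2l// ltrBlDl.
apply: hcontent_expanding => //; first exact: divr_gt0.
move=> x y _ _; rewrite /g opprD addrACA subrr add0r -scalerBr.
rewrite opprB addrA subrK enormZ gtr0_norm ?divr_gt0//.
by rewrite !mulrA divfK ?gt_eqF// divff ?gt_eqF// mul1r.
Qed.

(** The constant [c] relating content to volume; the proof of [hcontent_cube] shows that [fine]
    loses nothing when [0 < d]. *)
Definition unit_hcontent : R := fine (hcontent (cube 0 1)).

Lemma enorm_cube a s x y : 0 <= s -> cube a s x -> cube a s y ->
  enorm (x - y) <= d%:R * s.
Proof.
move=> s0 /cubeP xs /cubeP ys; apply: enorm_le_coord => // i.
by rewrite !mxE ler_norml; have := xs i; have := ys i; lra.
Qed.

Lemma hcontent_cube a (s : R) : (0 < d)%N -> 0 < s ->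
  hcontent (cube a s) = (s ^+ d * unit_hcontent)%:E.
Proof.
move=> d0 s0; rewrite EFinM fineK; last first.
  rewrite ge0_fin_numE ?cover_content_ge0//; last exact: diam_piece_ge0.
  (* The summand 1 makes the diameter bound [d] strict, as [diam_piece] demands. *)
  apply: le_lt_trans (ltry ((d%:R + 1) ^+ d)).
  apply: (cover_content_piece (diam_piece0 d0) diam_piece_ge0).
  exists (d%:R + 1) => //; split => // x y x1 y1.
  apply: (@le_lt_trans _ _ (d%:R * 1)); first exact: enorm_cube x1 y1.
  by rewrite mulr1 ltrDl.
apply/eqP; rewrite eq_le; apply/andP; split.
  by have := hcontent_le_scale a 0 s 1 d0 s0 ltr01; rewrite divr1.
rewrite -lee_pdivlMl ?exprn_gt0// -exprVn -div1r.
exact: hcontent_le_scale.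
Qed.

Lemma unit_hcontent_ge0 : 0 <= unit_hcontent.
Proof. by apply: fine_ge0; apply: cover_content_ge0; exact: diam_piece_ge0. Qed.

End HausdorffContent.

(** * Grids of small cubes and the limit of vanishing mesh *)

(** Lets the mesh tend to 0: a bound with an error term is written as a polynomial at [n.+1%:R^-1],
    and polynomials are continuous at 0. *)
Lemma lee_horner0 (R : realType) (p : {poly R}) (y : \bar R) : (0 <= y)%E ->
  (forall n, y <= (p.[n.+1%:R^-1])%:E)%E -> (y <= (p.[0])%:E)%E.
Proof.
move=> y0 yp.
have yfin : y \is a fin_num.
  by rewrite ge0_fin_numE//; exact: le_lt_trans (yp 0%N) (ltry _).
have h : p.[harmonic n] @[n --> \oo] --> p.[0].
  exact: cvg_comp cvg_harmonic (@continuous_horner R p 0).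
rewrite -(fineK yfin) lee_fin; apply: (cvgr_to_ge h); exists 0%N => // n _.
by rewrite /= -lee_fin fineK//; exact: yp.
Qed.

Lemma cover_content_finset {R : realType} {T : choiceType} {I : finType}
    {P : set T -> R -> Prop} (Q : pred I) (S : I -> set T) (A : set T) :
  P set0 0 -> (forall S w, P S w -> 0 <= w) ->
  A `<=` [set x | exists2 i, Q i & S i x] ->
  (cover_content P A <= \sum_(i | Q i) cover_content P (S i))%E.
Proof.
move=> P0 P_ge0 AS.
rewrite -big_filter.
apply: (le_trans _ (cover_content_bigsetU P0 P_ge0 _ _ _)).
apply: le_cover_content => x /AS[i Qi Six].
have : i \in [seq j <- index_enum I | Q j] by rewrite mem_filter Qi mem_index_enum.
by rewrite -bigcup_seq => ir; exists i.
Qed.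

Section Grid.
Context {R : realType} {d : nat}.
Implicit Types (a b x y : 'rV[R]_d) (S A : set 'rV[R]_d) (N : nat).

(** All axes share the bound [N], which makes the indices a finite type; boxes with unequal sides
    select a subfamily. *)
Definition cell a (h : R) N (j : {ffun 'I_d -> 'I_N}) : set 'rV[R]_d :=
  cube (a + \row_i (h * (j i)%:R)) h.

Lemma cell_covers a (h : R) N (m : 'I_d -> nat) x : 0 < h ->
  (forall i, (m i <= N)%N) ->
  (forall i, a 0 i <= x 0 i < a 0 i + h * (m i)%:R) ->
  exists2 j : {ffun 'I_d -> 'I_N},
    j \in family (fun i => [pred k : 'I_N | (k < m i)%N]) & cell a h N j x.
Proof.
(* The index of the cell is the integer part of the rescaled coordinate. *)
move=> h0 mN xm; pose t i := Num.truncn ((x 0 i - a 0 i) / h).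
have tP i : h * (t i)%:R <= x 0 i - a 0 i < h * (t i)%:R + h.
  have /andP[axi _] := xm i.
  have /truncn_itv/andP[] : 0 <= (x 0 i - a 0 i) / h.
    by rewrite divr_ge0 ?subr_ge0// ltW.
  rewrite ler_pdivlMr// ltr_pdivrMr// -/(t i) => t1 t2.
  by rewrite mulrC t1/= (lt_le_trans t2)// -natr1 mulrDl mul1r mulrC.
have tm i : (t i < m i)%N.
  have /andP[t1 _] := tP i; have /andP[_ x2] := xm i.
  rewrite -(ltr_nat R) -(ltr_pM2l h0); apply: le_lt_trans t1 _.
  by rewrite ltrBlDl.
exists [ffun i => Ordinal (leq_trans (tm i) (mN i))].
  by apply/familyP => i; rewrite ffunE; exact: tm.
apply/cubeP => i; rewrite !mxE ffunE/=; have := tP i.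
by move=> /andP[t1 t2]; rewrite -lerBrDl t1/= -addrA -ltrBlDl.
Qed.

Lemma sum_cells (h : R) N (m : 'I_d -> nat) : (forall i, (m i <= N)%N) ->
  \sum_(j : {ffun 'I_d -> 'I_N}
     | j \in family (fun i => [pred k : 'I_N | (k < m i)%N])) h ^+ d =
  \prod_i (h * (m i)%:R).
Proof.
move=> mN; transitivity (\prod_(i < d) \sum_(k < N | (k < m i)%N) h).
  rewrite (bigA_distr_big_dep (fun i (k : 'I_N) => (k < m i)%N) (fun=> fun=> h)).
  by apply: eq_bigr => j _; rewrite prodr_const card_ord.
apply: eq_bigr => i _.
by rewrite -(big_ord_widen _ (fun=> h))// sumr_const card_ord mulr_natr.
Qed.

Hypothesis d_gt0 : (0 < d)%N.
Local Notation c := (@unit_hcontent R d).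

Lemma hcontent_box a b : (hcontent (box a b) <= (c * box_vol a b)%:E)%E.
Proof.
have [[i ba]|/forallNP ab] := pselect (exists i, b 0 i <= a 0 i).
  have -> : box a b = set0.
    apply/seteqP; split => // x /(_ i)[ax xb].
    by have := lt_le_trans xb ba; rewrite ltNge ax.
  rewrite /hcontent (cover_content0 (diam_piece0 d_gt0) diam_piece_ge0).
  rewrite lee_fin mulr_ge0 ?unit_hcontent_ge0// prodr_ge0// => j _.
  by rewrite le_max lexx.
have {}ab i : a 0 i < b 0 i by rewrite ltNge; apply/negP/ab.
(* At [h], [p] is [c] times the volume of the box with every side lengthened by [h], which dominates
   the cells used; at 0 it is the target. *)
pose p : {poly R} := c *: \prod_(i < d) ((b 0 i - a 0 i)%:P + 'X).
have -> : c * box_vol a b = p.[0].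
  rewrite hornerZ horner_prod; congr (_ * _); apply: eq_bigr => i _.
  by rewrite hornerD hornerC hornerX addr0 max_r// subr_ge0 ltW.
apply: lee_horner0 => [|n].
  exact: cover_content_ge0 diam_piece_ge0 _.
set h := n.+1%:R^-1; have h0 : 0 < h by rewrite invr_gt0.
(* The successor makes the cells overshoot each side, by at most [h]. *)
pose m i := (Num.truncn ((b 0 i - a 0 i) / h)).+1.
pose N := (\max_(i < d) m i)%N.
have mN i : (m i <= N)%N by exact: leq_bigmax.
have mP i : b 0 i - a 0 i < h * (m i)%:R <= b 0 i - a 0 i + h.
  have /truncn_itv/andP[] : 0 <= (b 0 i - a 0 i) / h.
    by rewrite divr_ge0 ?subr_ge0// ltW.
  rewrite ler_pdivlMr// ltr_pdivrMr// => t1 t2.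
  by rewrite mulrC t2/= -natr1 mulrDl mul1r lerD2r.
apply: le_trans (cover_content_finset
    (fun j => j \in family (fun i => [pred k : 'I_N | (k < m i)%N]))
    (cell a h N) (box a b) (diam_piece0 d_gt0) diam_piece_ge0 _) _.
  move=> x xab; apply: cell_covers => // i.
  have [-> xb] := xab i; rewrite /= (lt_trans xb)//.
  by rewrite -ltrBlDl; have /andP[] := mP i.
under eq_bigr => j _ do rewrite -/hcontent /cell hcontent_cube//.
rewrite sumEFin lee_fin -mulr_suml sum_cells// /p hornerZ horner_prod mulrC.
rewrite ler_wpM2l ?unit_hcontent_ge0// ler_prod// => i _.
by rewrite mulr_ge0 ?ler0n ?(ltW h0)//= hornerD hornerC hornerX; have /andP[] := mP i.
Qed.
End Grid.

Lemma cover_content_compare {R : realType} {T : choiceType}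
    {P Q : set T -> R -> Prop} {K : R} {A : set T} :
  P set0 0 -> (forall S w, P S w -> 0 <= w) -> (forall S w, Q S w -> 0 <= w) ->
  0 < K -> (forall S w, Q S w -> (cover_content P S <= (K * w)%:E)%E) ->
  (cover_content P A <= K%:E * cover_content Q A)%E.
Proof.
move=> P0 P_ge0 Q_ge0 K0 QP.
have := @cover_content_transport R T T P Q setT id K A P0 P_ge0 Q_ge0 K0.
rewrite !setTI preimage_id; apply => S w QSw.
by rewrite setTI preimage_id; exact: QP.
Qed.

(** * Comparison of Lebesgue measure with Hausdorff content *)

Section Isodiametric.
Context {R : realType} {d : nat}.
Hypothesis d_gt0 : (0 < d)%N.
Implicit Types (a b x y : 'rV[R]_d) (S A : set 'rV[R]_d) (r : R).
Local Notation c := (@unit_hcontent R d).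
Local Notation leb := (@leb R d).
Local Notation hcontent := (@hcontent R d).

Lemma coord_le_enorm (v : 'rV[R]_d) i : `|v 0 i| <= enorm v.
Proof.
rewrite -(@ler_pXn2r _ 2) ?nnegrE ?enorm_ge0// sqr_enorm real_normK ?num_real//.
rewrite (bigD1 i)//= lerDl sumr_ge0// => j _; exact: sqr_ge0.
Qed.

Lemma sub_cube S x r : S x -> (forall y z, S y -> S z -> enorm (y - z) < r) ->
  S `<=` cube (x - const_mx r) (2 * r).
Proof.
move=> Sx Sr y Sy; apply/cubeP => i.
have := le_lt_trans (coord_le_enorm (y - x) i) (Sr y x Sy Sx).
by rewrite !mxE ltr_norml; lra.
Qed.

Lemma leb_cube a r : 0 <= r -> (leb (cube a r) <= (r ^+ d)%:E)%E.
Proof.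
move=> r0; rewrite lebE.
apply: (cover_content_piece (box_piece0 d_gt0) box_piece_ge0).
exists a, (a + const_mx r); split => //; rewrite /box_vol.
rewrite (eq_bigr (fun=> r)) ?prodr_const ?card_ord// => i _.
by rewrite !mxE addrAC subrr add0r max_r.
Qed.

(** A crude bound from an enclosing cube. It gives the finiteness of [leb S] in [isodiametric] and
    serves the degenerate case [c = 0] of [leb_expanding]. *)
Lemma leb_diam_piece S w : diam_piece S w -> (leb S <= (2 ^+ d * w)%:E)%E.
Proof.
move=> [r r0 [-> Sr]]; have [->|/set0P[x Sx]] := eqVneq S set0.
  rewrite lebE (cover_content0 (box_piece0 d_gt0) box_piece_ge0) lee_fin.
  by rewrite mulr_ge0 ?exprn_ge0.
rewrite -exprMn; apply: (@le_trans _ _ (leb (cube (x - const_mx r) (2 * r)))).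
  by rewrite lebE; apply: le_cover_content; exact: sub_cube.
by apply: leb_cube; rewrite mulr_ge0.
Qed.

(* Fill a cube of side [2 * r] around [S] with a fine grid and split its cells
   into those meeting [S] and the others.  The union of the former has diameter
   about [r], while the others contribute exactly [c] times their volume to the
   subadditive bound on the content of the cube, which is itself exactly [c]
   times its volume; so [c] times the volume of the cells meeting [S] is at most
   about [r ^+ d]. *)
Lemma isodiametric S w : diam_piece S w -> (c%:E * leb S <= w%:E)%E.
Proof.
move=> Sw; have wS := leb_diam_piece _ _ Sw.
have leb_ge0 : (0 <= leb S)%E.
  by rewrite lebE; exact: cover_content_ge0 box_piece_ge0 _.
have lebfin : leb S \is a fin_num.
  by rewrite ge0_fin_numE//; exact: le_lt_trans wS (ltry _).
have [r r0 [wr Sr]] := Sw.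
have [S0|/set0P[x0 Sx0]] := eqVneq S set0.
  rewrite S0 lebE (cover_content0 (box_piece0 d_gt0) box_piece_ge0) mule0.
  by rewrite lee_fin wr exprn_ge0.
have r_gt0 : 0 < r.
  by apply: le_lt_trans (Sr _ _ Sx0 Sx0); exact: enorm_ge0.
(* With mesh [h = 2 * r / N], the value of [p] at [1 / N] is [(r + 2 * (d * h)) ^+ d], the price of
   the union of the cells meeting [S]. *)
pose p : {poly R} := (r%:P + (4 * d%:R * r) *: 'X) ^+ d.
have -> : w = p.[0] by rewrite wr /p horner_exp hornerD hornerC hornerZ hornerX mulr0 addr0.
apply: lee_horner0 => [|n]; first by rewrite mule_ge0// lee_fin unit_hcontent_ge0.
pose N := n.+1; pose h : R := 2 * r / N%:R.
have N0 : 0 < N%:R :> R by rewrite ltr0n.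
have h0 : 0 < h by rewrite divr_gt0// mulr_gt0.
have -> : p.[n.+1%:R^-1] = (r + 2 * (d%:R * h)) ^+ d.
  rewrite /p horner_exp hornerD hornerC hornerZ hornerX /h /N.
  by congr (_ ^+ d); ring.
set a := x0 - const_mx r.
have hN : h * N%:R = 2 * r by rewrite /h divfK// gt_eqF.
have grid x : cube a (2 * r) x ->
    exists j : {ffun 'I_d -> 'I_N}, cell a h N j x.
  move=> /cubeP ax.
  have [i|j _ xj] := cell_covers a h N (fun=> N) x h0 (fun=> leqnn N).
    by rewrite hN; exact: ax.
  by exists j.
pose J (j : {ffun 'I_d -> 'I_N}) := `[< exists2 x, S x & cell a h N j x >].
have lebJ : (leb S <= (\sum_(j | J j) h ^+ d)%:E)%E.
  rewrite -sumEFin; apply: (@le_trans _ _ (\sum_(j | J j) leb (cell a h N j))%E).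
    rewrite lebE; apply: (cover_content_finset J _ _ (box_piece0 d_gt0)).
      exact: box_piece_ge0.
    move=> x Sx; have [j xj] := grid x (sub_cube _ _ _ Sx0 Sr _ Sx).
    by exists j => //; apply/asboolP; exists x.
  by apply: lee_sum => j _; apply: leb_cube; exact: ltW.
have HJ : ((2 * r) ^+ d * c <=
    (r + 2 * (d%:R * h)) ^+ d + \sum_(j | ~~ J j) h ^+ d * c).
  pose U := [set x | exists2 j, J j & cell a h N j x].
  rewrite -lee_fin -(hcontent_cube a)// ?mulr_gt0// EFinD -sumEFin.
  under eq_bigr => j _ do rewrite -(hcontent_cube (a + \row_i (h * (j i)%:R)))//.
  apply: (@le_trans _ _ (hcontent U +
      hcontent [set x | exists2 j, ~~ J j & cell a h N j x])%E).
    apply: le_trans (cover_contentU (diam_piece0 d_gt0) diam_piece_ge0 _ _).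
    apply: le_cover_content => x /grid[j xj].
    by case: (boolP (J j)) => Jj; [left|right]; exists j.
  apply: leeD; last first.
    exact: (cover_content_finset _ _ _ (diam_piece0 d_gt0) diam_piece_ge0).
  apply: (cover_content_piece (diam_piece0 d_gt0) diam_piece_ge0).
  have h2 : 0 <= 2 * (d%:R * h) by rewrite !mulr_ge0// ltW.
  exists (r + 2 * (d%:R * h)); first by rewrite addr_ge0.
  split => // x y [j /asboolP[x' Sx' jx'] jx] [k /asboolP[y' Sy' ky'] ky].
  (* Each of [x], [y] is within [d * h] of a point of [S] in its own cell, whence the error
     [2 * (d * h)]. *)
  have -> : x - y = (x - x') + ((x' - y') + (y' - y)).
    by rewrite [(x' - y') + _]addrA subrK addrA subrK.
  apply: le_lt_trans (ler_enormD _ _) _.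
  apply: (@le_lt_trans _ _ (d%:R * h + (enorm (x' - y') + d%:R * h))).
    apply: lerD; first exact: enorm_cube (ltW h0) jx jx'.
    apply: le_trans (ler_enormD _ _) _; rewrite lerD2l.
    exact: enorm_cube (ltW h0) ky' ky.
  by have := Sr _ _ Sx' Sy'; lra.
have tot : \sum_(j | J j) h ^+ d + \sum_(j | ~~ J j) h ^+ d = (2 * r) ^+ d.
  rewrite -(bigID J xpredT)/= sumr_const card_ffun !card_ord -hN.
  by rewrite -[LHS]mulr_natr natrX -exprMn.
rewrite -(fineK lebfin) -EFinM lee_fin.
apply: (@le_trans _ _ (c * \sum_(j | J j) h ^+ d)).
  by rewrite ler_wpM2l ?unit_hcontent_ge0// -lee_fin fineK.
(* Once the volume of the cube is split over the two families, the cells missing [S] cancel. *)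
move: HJ; rewrite -mulr_suml -tot.
by rewrite mulrDl lerD2r mulrC.
Qed.

(** Stated for [t] above [c] so that a positive factor is at hand even when [c = 0]. *)
Lemma hcontent_le_leb A (t : R) : 0 < t -> c <= t ->
  (hcontent A <= t%:E * leb A)%E.
Proof.
move=> t0 ct; rewrite lebE; apply: cover_content_compare => //.
- exact: diam_piece0.
- exact: diam_piece_ge0.
- exact: box_piece_ge0.
- move=> S w Sw; have w0 := box_piece_ge0 _ _ Sw.
  case: Sw => a [b [-> wE]].
  apply: (le_trans (hcontent_box d_gt0 a b)).
  by rewrite -wE lee_fin ler_wpM2r.
Qed.

(** Applied with [t = c^-1], from [isodiametric], and with [t = 2 ^+ d], from [leb_diam_piece]. *)
Lemma leb_le_hcontent A (t : R) : 0 < t ->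
  (forall S w, diam_piece S w -> leb S <= (t * w)%:E)%E ->
  (leb A <= t%:E * hcontent A)%E.
Proof.
move=> t0 St; rewrite lebE; apply: cover_content_compare => //.
- exact: box_piece0.
- exact: box_piece_ge0.
- exact: diam_piece_ge0.
- by move=> S w /St; rewrite lebE.
Qed.

(** Pass to the content, pull back there at cost [K ^+ d], and return: the factors [c^-1] and [c] of
    the two passages cancel. *)
Lemma leb_expanding (F : set 'rV[R]_d) (g : 'rV[R]_d -> 'rV[R]_d)
    (K : R) A : 0 < K ->
  (forall x y, F x -> F y -> enorm (x - y) <= K * enorm (g x - g y)) ->
  (leb (F `&` g @^-1` A) <= (K ^+ d)%:E * leb A)%E.
Proof.
move=> K0 Fg.
have Kd : 0 < K ^+ d by exact: exprn_gt0.
have lebA0 : (0 <= leb A)%E by rewrite lebE; exact: cover_content_ge0 box_piece_ge0 _.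
have [Aoo|Afin] := eqVneq (leb A) +oo%E.
  by rewrite Aoo gt0_muley ?lte_fin ?leey.
have bound (s t : R) : 0 < s -> c <= s -> 0 < t ->
    (forall S w, diam_piece S w -> leb S <= (t * w)%:E)%E ->
    (leb (F `&` g @^-1` A) <= (t * K ^+ d * s)%:E * leb A)%E.
  move=> s0 cs t0 St; apply: le_trans (leb_le_hcontent _ _ t0 St) _.
  rewrite -mulrA !EFinM -!muleA lee_pmul2l//.
  apply: le_trans (hcontent_expanding _ _ _ _ d_gt0 K0 Fg) _.
  by rewrite lee_pmul2l//; exact: hcontent_le_leb.
(* [c] does not vanish, but refuting [c = 0] is not needed: it would make every
   set of finite measure null. *)
have [c0|c_neq0] := eqVneq c 0.
  pose p : {poly R} := (2 ^+ d * K ^+ d * fine (leb A)) *: 'X.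
  apply: (@le_trans _ _ (p.[0])%:E); last first.
    by rewrite hornerZ hornerX mulr0 mule_ge0// lee_fin ltW.
  apply: lee_horner0 => [|n].
    by rewrite lebE; exact: cover_content_ge0 box_piece_ge0 _.
  rewrite hornerZ hornerX.
  apply: (le_trans (bound n.+1%:R^-1 (2 ^+ d) _ _ _ leb_diam_piece)).
  - by rewrite invr_gt0.
  - by rewrite c0.
  - exact: exprn_gt0.
  by rewrite -{1}(@fineK _ (leb A)) ?ge0_fin_numE ?ltey// -EFinM mulrAC.
have c0 : 0 < c by rewrite lt_neqAle eq_sym c_neq0 unit_hcontent_ge0.
have := bound c c^-1 c0 (lexx _).
rewrite invr_gt0 mulrAC mulVf// mul1r; apply => // S w Sw.
by rewrite EFinM lee_pdivlMl// isodiametric.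
Qed.

End Isodiametric.

(* In dimension 0 every box is the whole space and has volume 1 (an empty
   product), so covering even the empty set costs [+oo]. *)
Lemma leb_dim0 (R : realType) (A : set 'rV[R]_0) : leb A = +oo%E.
Proof.
apply/eqP; rewrite -leye_eq; apply: le_ereal_inf_tmp => _ [a [b [_ ->]]].
have box1 k : box_vol (a k) (b k) = 1 by rewrite /box_vol big_ord0.
rewrite leye_eq; apply/eqP/eqyP => t _; have [n tn] : exists n : nat, t <= n%:R.
  by exists (Num.truncn `|t|).+1; apply: le_trans (ler_norm t) (ltW (truncnS_gt _)).
apply: (@le_trans _ _ (n%:R)%:E); first by rewrite lee_fin.
rewrite (@nneseries_split _ _ 0 n) => [|k _]; last by rewrite box1.
under eq_bigr do rewrite box1.
rewrite add0n sumEFin sumr_const_nat subn0 leeDl//.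
by apply: nneseries_ge0 => k _ _; rewrite box1.
Qed.

(** Inductively the sum with one more term is at most [2 * q ^+ n], which the next power absorbs. *)
Lemma sum_expr_le (R : realType) (q : R) n : 2 <= q ->
  \sum_(i < n) q ^+ i <= q ^+ n.
Proof.
move=> q2; have q0 : 0 <= q by apply: le_trans q2.
elim: n => [|n IH]; first by rewrite big_ord0 expr0.
rewrite big_ord_recr/= exprS; apply: (@le_trans _ _ (2 * q ^+ n)).
  by rewrite mulr2n mulrDl mul1r lerD2r.
by rewrite ler_wpM2r ?exprn_ge0.
Qed.

(** * Gradient descent and the initial points that reach [X] *)

Section GradientDescent.
Context {R : realType} {d : nat}.
Variables (f : 'rV[R]_d -> R) (X : set 'rV[R]_d) (L gamma : R).
Hypotheses (f_smooth : L_smooth_on f L (~` X)) (gamma_gt0 : 0 < gamma)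
  (gamma_le : gamma <= 1 / (2 * L)).
Local Notation step := (fun x => x - gamma *: grad f x).

(** [x - y] is the difference of the steps plus [gamma] times that of the gradients. Since
    [gamma * L <= 2^-1], the latter has norm at most half of [enorm (x - y)] and is absorbed on the
    left. *)
Lemma gd_step_expanding x y : (~` X) x -> (~` X) y ->
  enorm (x - y) <= 2 * enorm (step x - step y).
Proof.
move=> Xx Xy; have [L0 [_ /(_ x y Xx Xy) gradL]] := f_smooth.
have gL : gamma * L <= 2^-1.
  by move: gamma_le; rewrite ler_pdivlMr ?mulr_gt0//; lra.
have split_xy (u v : 'rV[R]_d) :
    x - y = ((x - gamma *: u) - (y - gamma *: v)) + gamma *: (u - v).
  by apply/rowP => i; rewrite !mxE; ring.
move: gradL; rewrite /=; move: (grad f x) (grad f y) => u v uv.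
have : gamma * enorm (u - v) <= 2^-1 * enorm (x - y).
  apply: (@le_trans _ _ (gamma * (L * enorm (x - y)))).
    by rewrite ler_pM2l.
  by rewrite mulrA ler_wpM2r ?enorm_ge0.
have := ler_enormD ((x - gamma *: u) - (y - gamma *: v)) (gamma *: (u - v)).
rewrite -split_xy enormZ gtr0_norm//.
move: (enorm _) (enorm _) (enorm _) => p q r; lra.
Qed.

(** The starting points whose run avoids [X] before time [i] and lies in [X] at time [i]. *)
Definition first_hit i : set 'rV[R]_d :=
  iter i (fun B => ~` X `&` step @^-1` B) X.

Lemma leb_first_hit i : (0 < d)%N ->
  (leb (first_hit i) <= ((2 ^+ d) ^+ i)%:E * leb X)%E.
Proof.
move=> d0; elim: i => [|i IH]; first by rewrite expr0 mul1e.
apply: le_trans (leb_expanding d0 _ step 2 (first_hit i) _ gd_step_expanding) _ => //.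
by rewrite exprS EFinM -muleA lee_pmul2l// lte_fin exprn_gt0.
Qed.

Lemma gd_hits x i : X (gd f gamma x i) -> exists2 k, (k <= i)%N & first_hit k x.
Proof.
rewrite /gd; elim: i x => [|i IH] x; first by exists 0%N.
have [Xx _|Xx] := pselect (X x); first by exists 0%N.
by rewrite iterSr => /IH[k ki kx]; exists k.+1.
Qed.

Lemma leb_gd_hits T : (0 < d)%N ->
  (leb [set x | exists i, (1 <= i <= T)%N /\ X (gd f gamma x i)] <=
   (2 ^+ (T.+1 * d))%:E * leb X)%E.
Proof.
move=> d0.
have leb_ge0 A : (0 <= @leb R d A)%E.
  by rewrite lebE; exact: cover_content_ge0 box_piece_ge0 _.
(* Time 0 must be counted, since a run in [X] at a later time may have started there; hence [T.+1]
   terms. *)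
apply: (@le_trans _ _ (\sum_(i < T.+1) leb (first_hit i))%E).
  rewrite lebE; apply: (cover_content_finset xpredT _ _ (box_piece0 d0)).
    exact: box_piece_ge0.
  move=> x [i [/andP[_ iT] /gd_hits[k ki kx]]].
  by exists (Ordinal (leq_ltn_trans ki (leq_ltn_trans iT (ltnSn T)))).
apply: (@le_trans _ _ (\sum_(i < T.+1) ((2 ^+ d) ^+ i)%:E * leb X)%E).
  by apply: lee_sum => i _; exact: leb_first_hit.
rewrite -ge0_sume_distrl; last by move=> i _; rewrite lee_fin !exprn_ge0.
rewrite sumEFin lee_wpmul2r// lee_fin mulnC exprM; apply: sum_expr_le.
by rewrite -{1}(expr1 2) ler_weXn2l// ler1n.
Qed.

End GradientDescent.

Theorem theorem1 (R : realType) (d : nat) (f : 'rV[R]_d -> R)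
  (X W : set 'rV[R]_d) (L gamma : R) (T : nat) :
  leb_measurable X ->
  L_smooth_on f L (~` X) ->
  leb_measurable W ->
  (0 < leb W)%E -> (leb W < +oo)%E ->
  0 < gamma -> gamma <= 1 / (2 * L) ->
  (1 <= T)%N ->
  ((unif_prob W
      [set x0 | exists i : nat, (1 <= i <= T)%N /\ X (gd f gamma x0 i)])%:E
   <= (2 ^+ (T.+1 * d))%:E * leb X * ((fine (leb W))^-1)%:E)%E.
Proof.
move=> _ f_smooth _ W_gt0 W_fin gamma_gt0 gamma_le _.
(* In dimension 0 [leb W] would be infinite, against the assumption on [W]. *)
have [d0|d_gt0] := posnP d.
  by subst d; move: W_fin; rewrite leb_dim0.
have leb_ge0 A : (0 <= @leb R d A)%E.
  by rewrite lebE; exact: cover_content_ge0 box_piece_ge0 _.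
rewrite /unif_prob EFinM; apply: lee_wpmul2r.
  by rewrite lee_fin invr_ge0 fine_ge0.
set E := [set x0 | _].
have le_leb A B : A `<=` B -> (@leb R d A <= leb B)%E.
  by rewrite lebE; exact: le_cover_content.
rewrite fineK; last first.
  by rewrite ge0_fin_numE//; exact: le_lt_trans (le_leb _ _ (@subIsetl _ _ _)) W_fin.
apply: (@le_trans _ _ (leb E)); first exact: le_leb (@subIsetr _ _ _).
exact: leb_gd_hits f_smooth gamma_gt0 gamma_le _ d_gt0.
Qed.
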